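(* Let $\mathcal X$ be a finite multi-set of real symmetric $2\times2$ matrices. Let $\lambda_1$ be (one of) the largest eigenvalue(s) of $\mathcal X$, $u_1$ the eigenvector associated with $\lambda_1$ and $v_1\perp u_1$ the minor eigenvector of the same matrix of $\mathcal X$, and let $\lambda_2\le\lambda_1$ be the next largest eigenvalue of $\mathcal X$ (the largest element of the eigenvalue multi-set after removing one occurrence of $\lambda_1$). Then $$\mathrm{Sup}_{\mathrm{RLE}}(\mathcal X)=\begin{cases}\lambda_1u_1u_1^{\mathsf T}+\lambda_2v_1v_1^{\mathsf T},&\text{if }\lambda_1\text{ is unique},\\ \lambda_1I,&\text{otherwise}.\end{cases}$$
   Context: $I$ is the $2\times2$ identity. ''The eigenvalues of $\mathcal X$'' is the multi-set of both eigenvalues of every matrix of $\mathcal X$; unique means occurring exactly once. $\mathrm{Sup}_{\mathrm{LE}}(\mathcal X):=\lim_{m\to\infty}\frac1m\log\sum_{X\in\mathcal X}\exp(mX)$. Write $X_i=\lambda_iu_iu_i^{\mathsf T}+\mu_iv_iv_i^{\mathsf T}$ (spectral form, $\lambda_i\ge\mu_i$, orthonormal $u_i,v_i$). The multi-set of bases $\{\{u_i,v_i\}\}_i$ is generic if for no $i\neq j$ the vector $u_i$ is aligned (equal up to sign) with $u_j$. Families $\mathcal X^{(\delta)}=\{X_1^{(\delta)},\dots,X_n^{(\delta)}\}$ converge planar to $\mathcal X$ if $X_i^{(\delta)}\to X_i$ as $\delta\to0$ and $X_i^{(\delta)}$ has the same eigenvalues as $X_i$ for all $i,\delta$. The relaxed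 log-exp-supremum is $\mathrm{Sup}_{\mathrm{RLE}}(\mathcal X):=\mathrm{Sup}_{\mathrm{LE}}(\mathcal X)$ if the bases of $\mathcal X$ are generic, and otherwise $\mathrm{Sup}_{\mathrm{RLE}}(\mathcal X):=\lim_{\delta\to0}\mathrm{Sup}_{\mathrm{LE}}(\mathcal X^{(\delta)})$ over families $\mathcal X^{(\delta)}$ converging planar to $\mathcal X$ with generic bases. *)

(* Defs.v *)
From HB Require Import structures.
From mathcomp Require Import all_boot all_order all_algebra.
From mathcomp Require Import all_classical all_reals all_analysis.
Set Implicit Arguments. Unset Strict Implicit. Unset Printing Implicit Defensive.
Import Order.TTheory GRing.Theory Num.Theory.
Import numFieldNormedType.Exports.
Local Open Scope classical_set_scope.
Local Open Scope ring_scope.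

Section Defs.
Variable R : realType.

Definition mexp (A : 'M[R]_2) : 'M[R]_2 :=
  \matrix_(i, j) lim ((fun N : nat => \sum_(k < N) (A ^+ k) i j / (k`!)%:R) @ \oo).

Definition sym_mx (A : 'M[R]_2) : Prop := A^T = A.

(* Matrix logarithm: the (unique) real sym_mx L with exp L = S
   (defined for sym_mx positive definite S; 0 otherwise). *)
Definition mlog (S : 'M[R]_2) : 'M[R]_2 :=
  xget 0 [set L : 'M[R]_2 | sym_mx L /\ mexp L = S].

Definition spectral_form (X : 'M[R]_2) (l m : R) (u v : 'cV[R]_2) : Prop :=
  [/\ u^T *m u = 1, v^T *m v = 1, u^T *m v = 0, m <= l &
      X = l *: (u *m u^T) + m *: (v *m v^T)].

Definition SupLE_is (n : nat) (Xs : 'I_n -> 'M[R]_2) (L : 'M[R]_2) : Prop :=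
  (fun m : R => m^-1 *: mlog (\sum_(i < n) mexp (m *: Xs i))) @ +oo --> L.

Definition generic_bases (n : nat) (Xs : 'I_n -> 'M[R]_2) : Prop :=
  exists (l m : 'I_n -> R) (u v : 'I_n -> 'cV[R]_2),
    (forall i, spectral_form (Xs i) (l i) (m i) (u i) (v i)) /\
    (forall i j, i != j -> u i <> u j /\ u i <> - u j).

Definition converges_planar (n : nat) (Xd : R -> 'I_n -> 'M[R]_2)
    (Xs : 'I_n -> 'M[R]_2) : Prop :=
  (forall i, (fun d => Xd d i) @ 0^'+ --> Xs i) /\
  (forall d, 0 < d -> forall i, sym_mx (Xd d i) /\
                               char_poly (Xd d i) = char_poly (Xs i)).

Definition SupRLE_is (n : nat) (Xs : 'I_n -> 'M[R]_2) (L : 'M[R]_2) : Prop :=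
  if `[< generic_bases Xs >] then SupLE_is Xs L
  else
    (exists Xd : R -> 'I_n -> 'M[R]_2, converges_planar Xd Xs /\
        forall d, 0 < d -> generic_bases (Xd d)) /\
    (forall Xd : R -> 'I_n -> 'M[R]_2,
       converges_planar Xd Xs -> (forall d, 0 < d -> generic_bases (Xd d)) ->
       exists S : R -> 'M[R]_2,
         (forall d, 0 < d -> SupLE_is (Xd d) (S d)) /\ S @ 0^'+ --> L).

End Defs.

(* Main.v *)
Require Import Defs.
From HB Require Import structures.
From mathcomp Require Import all_boot all_order all_algebra ring lra.
From mathcomp Require Import all_classical all_reals all_analysis.
Import Order.TTheory GRing.Theory Num.Theory.
Import numFieldNormedType.Exports.
Local Open Scope ring_scope.

(** Both cases of the formula are [lam1 u1 u1^T + lam2 v1 v1^T], since [lam2 = lam1]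
    when [lam1] is not unique.  For generic bases let [S] be the sum of the
    exponentials [exp (t X_i)], with eigenvalues [a >= b] and top eigenvector [p].
    The quadratic form of [S] at [u1], at [v1] and at its own eigenvectors shows that
    [a] and [b] agree with [exp (t lam1)] and [exp (t lam2)] up to a factor
    independent of [t]; genericity is used for the lower bound on [b], where two
    non-aligned major eigenvectors span the plane.  Also [(p . v1)^2] is at most of
    order [exp (- t (lam1 - lam2))], so [(lam1 - lam2) (p . v1)] tends to [0] and
    [log S / t] has the stated limit.  This limit is an affine function of [X_1] with
    coefficients depending only on eigenvalues, hence it passes to planar limits. *)

(** * Spectral forms of symmetric 2x2 matrices *)

Section TwoByTwo.
Context {R : realType}.
Implicit Types (A B X : 'M[R]_2) (l m x y p q : R).

Lemma sum_ord2 (V : nmodType) (F : 'I_2 -> V) : \sum_(i < 2) F i = F 0 + F 1.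
Proof.
rewrite big_ord_recl big_ord1; congr (_ + F _).
exact/val_inj.
Qed.

Lemma ord2P (P : 'I_2 -> Prop) : P 0 -> P 1 -> forall i, P i.
Proof.
move=> P0 P1 [[|[|//]] i2].
- by rewrite (_ : Ordinal i2 = 0) //; exact/val_inj.
- by rewrite (_ : Ordinal i2 = 1) //; exact/val_inj.
Qed.

Lemma mx2P A B : A 0 0 = B 0 0 -> A 0 1 = B 0 1 -> A 1 0 = B 1 0 ->
  A 1 1 = B 1 1 -> A = B.
Proof. by move=> *; apply/matrixP; do 2! elim/ord2P. Qed.

Lemma cV2P (u w : 'cV[R]_2) : u 0 0 = w 0 0 -> u 1 0 = w 1 0 -> u = w.
Proof. by move=> *; apply/colP; elim/ord2P. Qed.

Lemma det_mx2 A : \det A = A 0 0 * A 1 1 - A 0 1 * A 1 0.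
Proof.
rewrite (expand_det_row _ 0) sum_ord2 /cofactor !det_mx11 !mxE /=.
rewrite (_ : lift 0 0 = 1); last exact/val_inj.
rewrite (_ : lift 1 0 = 0); last exact/val_inj.
by rewrite addn0 add0n expr0 expr1 mul1r mulN1r mulrN.
Qed.

Lemma mxtrace2 A : \tr A = A 0 0 + A 1 1.
Proof. by rewrite /mxtrace sum_ord2. Qed.

(** A monic polynomial of degree two has two free coefficients, here the determinant and minus the
    trace. *)
Lemma char_poly2_eq A B :
  (char_poly A = char_poly B) <-> \tr A = \tr B /\ \det A = \det B.
Proof.
split=> [eAB|[eT eD]].
  split.
    by apply: oppr_inj; rewrite -!char_poly_trace // eAB.
  have := char_poly_det A; rewrite eAB char_poly_det.
  by rewrite expr2 mulrN1 opprK !mul1r => ->.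
apply/polyP => -[|[|[|i]]].
- by rewrite !char_poly_det eD.
- by rewrite !(char_poly_trace (n := 2)) // eT.
- have lc (C : 'M[R]_2) : (char_poly C)`_2 = 1 :> R.
    by have /monicP := char_poly_monic C; rewrite lead_coefE size_char_poly.
  by rewrite !lc.
- by rewrite !nth_default // size_char_poly.
Qed.

Definition line_proj x y : 'M[R]_2 :=
  \matrix_(i, j) ((if i == 0 then x else y) * (if j == 0 then x else y)).

(* In the plane the minor eigenvector is determined up to sign by the major one,
   so a spectral form is recorded by its eigenvalues and the unit vector (x, y). *)
Definition spec_mx l m x y : 'M[R]_2 := m%:M + (l - m) *: line_proj x y.

Lemma spec_mxE l m x y : x ^+ 2 + y ^+ 2 = 1 ->
  (spec_mx l m x y 0 0 = l * x ^+ 2 + m * y ^+ 2) *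
  (spec_mx l m x y 0 1 = (l - m) * (x * y)) *
  (spec_mx l m x y 1 0 = (l - m) * (x * y)) *
  (spec_mx l m x y 1 1 = l * y ^+ 2 + m * x ^+ 2).
Proof.
move=> e; rewrite !mxE /= mulr0n mulr1n !add0r.
have -> : y ^+ 2 = 1 - x ^+ 2 by rewrite -e; ring.
have ey : y * y = 1 - x ^+ 2 by rewrite -e; ring.
by rewrite ey; do ![split]; ring.
Qed.

Lemma spec_mx_sym l m x y : sym_mx (spec_mx l m x y).
Proof. by apply: mx2P; rewrite !mxE //= [y * x]mulrC. Qed.

(** The clause for arbitrary [a] and [b] serves the claimed supremum, which keeps the frame of a
    matrix but changes an eigenvalue. *)
Lemma spectral_form_spec_mx X l m (u v : 'cV[R]_2) : spectral_form X l m u v ->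
  [/\ u 0 0 ^+ 2 + u 1 0 ^+ 2 = 1, m <= l, X = spec_mx l m (u 0 0) (u 1 0) &
      forall a b, a *: (u *m u^T) + b *: (v *m v^T)
                  = spec_mx a b (u 0 0) (u 1 0)].
Proof.
case=> /matrixP/(_ 0 0) + /matrixP/(_ 0 0) + /matrixP/(_ 0 0) + ml ->.
rewrite !mxE !sum_ord2 !mxE /= ?mulr1n.
set x := u 0 0; set y := u 1 0; set p := v 0 0; set q := v 1 0.
move=> eu ev euv.
have eu2 : x ^+ 2 + y ^+ 2 = 1 by rewrite !expr2 eu.
(* The sign of [v] is undetermined, so only quadratic expressions in [p] and [q] are computed; they
   are those of [(- y, x)]. *)
have ep : p * p = y * y.
  have : p * p * (x * x + y * y) = y * y * (p * p + q * q)
    + (x * p - y * q) * (x * p + y * q) by ring.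
  by rewrite eu ev euv !mulr1 mulr0 addr0.
have eq : q * q = x * x by lra.
have epq : p * q = - (x * y).
  have : p * q * (x * x + y * y) = - (x * y) * (p * p + q * q)
    + (x * q + y * p) * (x * p + y * q) by ring.
  by rewrite eu ev euv !mulr1 mulr0 addr0.
have E a b : a *: (u *m u^T) + b *: (v *m v^T) = spec_mx a b x y.
  apply: mx2P; rewrite !spec_mxE // !mxE !big_ord1 !mxE /= -/x -/y -/p -/q.
  - by rewrite ep; ring.
  - by rewrite epq; ring.
  - by rewrite (mulrC q) epq; ring.
  - by rewrite eq; ring.
by split.
Qed.

Lemma spec_mx_spectral_form l m x y : x ^+ 2 + y ^+ 2 = 1 -> m <= l ->
  spectral_form (spec_mx l m x y) l m
    (\col_i (if i == 0 then x else y)) (\col_i (if i == 0 then - y else x)).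
Proof.
move=> e ml; split=> //.
- by apply/matrixP => i j; rewrite !ord1 !mxE sum_ord2 !mxE /= -!expr2.
- by apply/matrixP => i j; rewrite !ord1 !mxE sum_ord2 !mxE /= -e; ring.
- by apply/matrixP => i j; rewrite !ord1 !mxE sum_ord2 !mxE /=; ring.
- by apply: mx2P; rewrite !spec_mxE // !mxE !big_ord1 !mxE /=; ring.
Qed.

Lemma spec_mx_tr_det l m x y : x ^+ 2 + y ^+ 2 = 1 ->
  \tr (spec_mx l m x y) = l + m /\ \det (spec_mx l m x y) = l * m.
Proof.
move=> e; rewrite mxtrace2 det_mx2 !spec_mxE //.
have -> : y ^+ 2 = 1 - x ^+ 2 by rewrite -e; ring.
split; first by ring.
have -> : (l - m) * (x * y) * ((l - m) * (x * y)) =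
  (l - m) ^+ 2 * x ^+ 2 * y ^+ 2 by ring.
have -> : y ^+ 2 = 1 - x ^+ 2 by rewrite -e; ring.
by ring.
Qed.

(** The discriminant [(l - m) ^+ 2] is a function of sum and product, and the ordering selects its
    nonnegative root. *)
Lemma sum_prod_inj l m l' m' : m <= l -> m' <= l' ->
  l + m = l' + m' -> l * m = l' * m' -> l = l' /\ m = m'.
Proof.
move=> ml ml' es ep.
have : l - m = l' - m'.
  apply/eqP; rewrite -(eqrXn2 (n := 2)) ?subr_ge0 //; apply/eqP.
  have -> a b : (a - b) ^+ 2 = (a + b) ^+ 2 - 4 * (a * b) :> R by ring.
  by rewrite es ep; ring.
by move=> ed; split; lra.
Qed.

Lemma spec_mx_eigen_inj l m x y l' m' x' y' :
  x ^+ 2 + y ^+ 2 = 1 -> x' ^+ 2 + y' ^+ 2 = 1 -> m <= l -> m' <= l' ->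
  char_poly (spec_mx l m x y) = char_poly (spec_mx l' m' x' y') ->
  l = l' /\ m = m'.
Proof.
move=> e e' ml ml' /char_poly2_eq.
have [-> ->] := spec_mx_tr_det l m _ _ e.
have [-> ->] := spec_mx_tr_det l' m' _ _ e'.
by case; exact: sum_prod_inj.
Qed.

Lemma sym_mx_spec A : sym_mx A ->
  exists l m x y, [/\ x ^+ 2 + y ^+ 2 = 1, m <= l & A = spec_mx l m x y].
Proof.
move=> /matrixP/(_ 0 1); rewrite mxE => e10.
have [b0|b0] := eqVneq (A 0 1) 0.
  have [ad|ad] := leP (A 1 1) (A 0 0).
    exists (A 0 0), (A 1 1), 1, 0.
    have e : 1 ^+ 2 + 0 ^+ 2 = 1 :> R by ring.
    by split=> //; apply: mx2P; rewrite !spec_mxE ?e10 ?b0 //; ring.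
  exists (A 1 1), (A 0 0), 0, 1.
  have e : 0 ^+ 2 + 1 ^+ 2 = 1 :> R by ring.
  by split=> //; [exact: ltW|apply: mx2P; rewrite !spec_mxE ?e10 ?b0 //; ring].
set a := A 0 0; set b := A 0 1 in b0 *; set d := A 1 1.
(* [D] is the root of the discriminant, [l] and [m] solve the characteristic equation, [(b, l - a)]
   is an eigenvector for [l], and [N] is its length. *)
pose D := Num.sqrt ((a - d) ^+ 2 + 4 * b ^+ 2).
have D2 : D ^+ 2 = (a - d) ^+ 2 + 4 * b ^+ 2.
  rewrite sqr_sqrtr //; have := sqr_ge0 (a - d); have := sqr_ge0 b; lra.
have D0 : 0 <= D by rewrite sqrtr_ge0.
pose l := (a + d + D) / 2; pose m := (a + d - D) / 2.
have b2 : 0 < b ^+ 2 by rewrite exprn_even_gt0.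
pose N := Num.sqrt (b ^+ 2 + (l - a) ^+ 2).
have N2 : N ^+ 2 = b ^+ 2 + (l - a) ^+ 2.
  by rewrite sqr_sqrtr // addr_ge0 ?sqr_ge0.
have N0 : N != 0.
  rewrite -sqrf_eq0 N2; apply: lt0r_neq0.
  by rewrite ltr_pwDl // sqr_ge0.
have elm : b ^+ 2 = (l - a) * (l - d).
  have : (l - a) * (l - d) = (D ^+ 2 - (a - d) ^+ 2) / 4 by rewrite /l; field.
  by rewrite D2 => ->; field.
have em : m = a + d - l by rewrite /m /l; field.
have ml : m <= l by rewrite /l /m; lra.
have N2' : N ^+ 2 = (l - a) * (l - m) by rewrite N2 elm em; ring.
exists l, m, (b / N), ((l - a) / N).
have e1 : (b / N) ^+ 2 + ((l - a) / N) ^+ 2 = 1.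
  by rewrite !expr_div_n -mulrDl -N2 divff // expf_neq0.
split=> //.
have la : l - a != 0.
  by apply: contraNneq b0 => h; rewrite -sqrf_eq0 elm h mul0r.
have lm : l - m != 0.
  by apply: contraNneq N0 => h; rewrite -sqrf_eq0 N2' h mulr0.
clearbody N l m.
apply: mx2P; rewrite !spec_mxE // ?expr_div_n ?mulf_div -?expr2 ?e10
  -/a -/b -/d N2' ?elm.
- by rewrite em; field; rewrite la -em lm.
- by field; rewrite la lm.
- by field; rewrite la lm.
- by rewrite em; field; rewrite la -em lm.
Qed.

End TwoByTwo.

(** * Exponential, logarithm and quadratic form in spectral coordinates *)

Section ExpLog.
Context {R : realType}.
Implicit Types (A B X : 'M[R]_2) (l m x y p q t : R).

(** Entries are linear in the eigenvalues, with coefficients that depend only on the frame; power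
    series therefore act on each eigenvalue separately. *)
Lemma spec_mxEproj l m x y i j : spec_mx l m x y i j =
  line_proj x y i j * l + ((1%:M : 'M[R]_2) i j - line_proj x y i j) * m.
Proof. by rewrite /spec_mx !mxE; case: (i == j); rewrite ?mulr1n ?mulr0n; ring. Qed.

Lemma scale_spec_mx t l m x y : t *: spec_mx l m x y = spec_mx (t * l) (t * m) x y.
Proof. by apply/matrixP => i j; rewrite mxE !spec_mxEproj; ring. Qed.

Lemma spec_mxX l m x y k : x ^+ 2 + y ^+ 2 = 1 ->
  spec_mx l m x y ^+ k = spec_mx (l ^+ k) (m ^+ k) x y.
Proof.
move=> e; elim: k => [|k IH].
  by rewrite !expr0 /spec_mx subrr scale0r addr0.
rewrite exprS IH; have ey : y ^+ 2 = 1 - x ^+ 2 by rewrite -e; ring.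
apply: mx2P; rewrite [LHS]mxE !sum_ord2 !spec_mxE // ?(exprS l k) ?(exprS m k); last first.
- have -> : (l - m) * (x * y) * ((l ^+ k - m ^+ k) * (x * y)) =
    (l - m) * (l ^+ k - m ^+ k) * x ^+ 2 * y ^+ 2 by ring.
  by rewrite ey; ring.
- set L := l ^+ k; set M := m ^+ k.
  transitivity (x * y * ((l * L - m * M) * (x ^+ 2 + y ^+ 2))); first by ring.
  by rewrite e; ring.
- set L := l ^+ k; set M := m ^+ k.
  transitivity (x * y * ((l * L - m * M) * (x ^+ 2 + y ^+ 2))); first by ring.
  by rewrite e; ring.
- have -> : (l - m) * (x * y) * ((l ^+ k - m ^+ k) * (x * y)) =
    (l - m) * (l ^+ k - m ^+ k) * x ^+ 2 * y ^+ 2 by ring.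
  by rewrite ey; ring.
Qed.

Lemma mexp_spec_mx l m x y : x ^+ 2 + y ^+ 2 = 1 ->
  mexp (spec_mx l m x y) = spec_mx (expR l) (expR m) x y.
Proof.
move=> e; apply/matrixP => i j; rewrite mxE spec_mxEproj.
set P := line_proj x y i j; set Q := _ - P.
apply/cvg_lim => //.
rewrite (_ : (fun N => _) =
  (fun N => P * series (exp_coeff l) N + Q * series (exp_coeff m) N)).
  by apply: cvgD; apply: cvgMr; exact: is_cvg_series_exp_coeff.
apply/funext => N; rewrite /series /= !big_mkord !mulr_sumr -big_split /=.
apply: eq_bigr => k _.
by rewrite spec_mxX // spec_mxEproj -/P -/Q mulrDl !mulrA.
Qed.

(** [mlog] is a choice among symmetric logarithms, so uniqueness is the point: the exponential
    determines both eigenvalues and, when they differ, the projection. The logarithm exhibited in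
    the other branch rules out the default value of [xget]. *)
Lemma mlog_spec_mx a b x y : 0 < b -> b <= a -> x ^+ 2 + y ^+ 2 = 1 ->
  mlog (spec_mx a b x y) = spec_mx (ln a) (ln b) x y.
Proof.
move=> b0 ba e; have a0 := lt_le_trans b0 ba.
rewrite /mlog; case: xgetP => [L _ [symL eL]|/(_ (spec_mx (ln a) (ln b) x y))].
  have [l [m [p [q [e' ml EL]]]]] := sym_mx_spec _ symL.
  move: eL; rewrite EL mexp_spec_mx // => eL.
  have [ela emb] : expR l = a /\ expR m = b.
    apply: (spec_mx_eigen_inj _ _ _ _ _ _ _ _ e' e) => //.
      by rewrite ler_expR.
    by rewrite eL.
  rewrite -ela -emb !expRK; rewrite -ela -emb in eL.
  have [lm|lm] := eqVneq l m; first by rewrite lm /spec_mx subrr !scale0r.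
  rewrite /spec_mx; move: eL => /addrI /scalerI -> //.
  by rewrite subr_eq0; apply: contraNneq lm => /expR_inj ->.
case; split; first exact: spec_mx_sym.
by rewrite mexp_spec_mx // !lnK.
Qed.

Definition quad A p q := A 0 0 * p ^+ 2 + (A 0 1 + A 1 0) * (p * q) + A 1 1 * q ^+ 2.

Lemma quad_sum (n : nat) (F : 'I_n -> 'M[R]_2) p q :
  quad (\sum_(i < n) F i) p q = \sum_(i < n) quad (F i) p q.
Proof. by rewrite /quad !summxE -!big_split /= !mulr_suml -!big_split. Qed.

(** [x * p + y * q] and [x * q - y * p] are the coordinates of [(p, q)] in the frame [(x, y)],
    [(- y, x)], that is, a cosine and a sine for unit vectors. *)
Lemma quad_spec_mx l m x y p q : x ^+ 2 + y ^+ 2 = 1 ->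
  quad (spec_mx l m x y) p q = l * (x * p + y * q) ^+ 2 + m * (x * q - y * p) ^+ 2.
Proof. by move=> e; rewrite /quad !spec_mxE //; ring. Qed.

Lemma Lagrange2 x y p q : x ^+ 2 + y ^+ 2 = 1 -> p ^+ 2 + q ^+ 2 = 1 ->
  (x * p + y * q) ^+ 2 + (x * q - y * p) ^+ 2 = 1.
Proof.
move=> e e'; transitivity ((x ^+ 2 + y ^+ 2) * (p ^+ 2 + q ^+ 2)); first by ring.
by rewrite e e' mulr1.
Qed.

Lemma quad_spec_mx_bounds l m x y p q : x ^+ 2 + y ^+ 2 = 1 ->
  p ^+ 2 + q ^+ 2 = 1 -> m <= l -> m <= quad (spec_mx l m x y) p q <= l.
Proof.
move=> e e' ml; rewrite quad_spec_mx //; have := Lagrange2 _ _ _ _ e e'.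
set c := _ ^+ 2; set s := _ ^+ 2; have c0 : 0 <= c by exact: sqr_ge0.
have s0 : 0 <= s by exact: sqr_ge0.
move=> cs; have -> : c = 1 - s by rewrite -cs addrK.
by apply/andP; split; nra.
Qed.

(** The logarithm turns the factor [C] into a summand [ln C], which division by [t] makes
    negligible. *)
Lemma log_ratio_bounds a t l C : 0 < t -> 1 <= C ->
  C^-1 * expR (t * l) <= a <= C * expR (t * l) -> `|t^-1 * ln a - l| <= ln C / t.
Proof.
move=> t0 C1 /andP[la ua]; have C0 : 0 < C by exact: lt_le_trans C1.
have a0 : 0 < a by apply: lt_le_trans la; rewrite mulr_gt0 ?invr_gt0 ?expR_gt0.
have u : ln a <= ln C + t * l.
  rewrite -[t * l]expRK -lnM ?posrE ?expR_gt0 // ler_ln ?posrE //.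
  by rewrite mulr_gt0 ?expR_gt0.
have d : - ln C + t * l <= ln a.
  rewrite -[t * l]expRK -lnV ?posrE // -lnM ?posrE ?invr_gt0 ?expR_gt0 //.
  by rewrite ler_ln ?posrE // mulr_gt0 ?invr_gt0 ?expR_gt0.
have -> : t^-1 * ln a - l = (ln a - t * l) / t by field; rewrite gt_eqF.
rewrite normrM (gtr0_norm (x := t^-1)) ?invr_gt0 //.
rewrite ler_wpM2r ?invr_ge0 ?(ltW t0) // ler_norml; apply/andP; split; lra.
Qed.

End ExpLog.

(** * Explicit error bounds for the log-exp sum *)

Section LogSumExp.
Context {R : realType}.
Implicit Types (A B X : 'M[R]_2) (a b l m x y p q t : R).

Lemma norm_dot_le1 x y p q : x ^+ 2 + y ^+ 2 = 1 -> p ^+ 2 + q ^+ 2 = 1 ->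
  `|x * p + y * q| <= 1.
Proof.
move=> e e'; rewrite -(@ler_sqr _ `|_|) ?nnegrE // real_normK ?num_real //.
by rewrite expr1n -(Lagrange2 _ _ _ _ e e') lerDl sqr_ge0.
Qed.

(** Once made homogeneous by means of the unit-length equations, each entry of the difference
    factors as the sine times, up to sign, an inner product of unit vectors. *)
Lemma line_proj_dist x y p q i j : x ^+ 2 + y ^+ 2 = 1 -> p ^+ 2 + q ^+ 2 = 1 ->
  `|line_proj p q i j - line_proj x y i j| <= `|x * q - y * p|.
Proof.
move=> e e'; have flip : x * (- q) + y * p = - (x * q - y * p) by ring.
have swap : q ^+ 2 + p ^+ 2 = 1 by rewrite addrC.
have neg : p ^+ 2 + (- q) ^+ 2 = 1 by rewrite sqrrN.
have E c d : `|c| <= 1 -> d = (x * q - y * p) * c -> `|d| <= `|x * q - y * p|.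
  by move=> c1 ->; rewrite normrM ler_piMr.
elim/ord2P: i; elim/ord2P: j; rewrite !mxE /=.
- apply: (E (- (x * q + y * p))); first by rewrite normrN norm_dot_le1.
  transitivity (p * p * (x ^+ 2 + y ^+ 2) - x * x * (p ^+ 2 + q ^+ 2)); last by ring.
  by rewrite e e' !mulr1.
- apply: (E (x * p + y * (- q))); first by rewrite norm_dot_le1.
  transitivity (p * q * (x ^+ 2 + y ^+ 2) - x * y * (p ^+ 2 + q ^+ 2)); last by ring.
  by rewrite e e' !mulr1.
- apply: (E (x * p + y * (- q))); first by rewrite norm_dot_le1.
  transitivity (q * p * (x ^+ 2 + y ^+ 2) - y * x * (p ^+ 2 + q ^+ 2)); last by ring.
  by rewrite e e' !mulr1.
- apply: (E (x * q + y * p)); first by rewrite norm_dot_le1.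
  transitivity (q * q * (x ^+ 2 + y ^+ 2) - y * y * (p ^+ 2 + q ^+ 2)); last by ring.
  by rewrite e e' !mulr1.
Qed.

(** The angle between the frames enters only through its product with the gap [l - m]; the frames
    need not be close when the gap is small. The three [K] bound the three terms with eigenvalue
    errors. *)
Lemma spec_mx_dist a b p q l m x y i j K E : x ^+ 2 + y ^+ 2 = 1 ->
  p ^+ 2 + q ^+ 2 = 1 -> `|a - l| <= K -> `|b - m| <= K -> 0 <= l - m ->
  (l - m) * `|x * q - y * p| <= E ->
  `|spec_mx a b p q i j - spec_mx l m x y i j| <= 3 * K + E.
Proof.
move=> e e' aK bK lm yE.
have I1 : `|(1%:M : 'M[R]_2) i j| <= 1.
  by rewrite mxE; case: (i == j); rewrite ?mulr1n ?mulr0n ?normr1 ?normr0.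
have P1 : `|line_proj p q i j| <= 1.
  have p1 : `|p| <= 1.
    by have := norm_dot_le1 _ _ 1 0 e'; rewrite mulr1 mulr0 addr0; apply; ring.
  have q1 : `|q| <= 1.
    by have := norm_dot_le1 _ _ 0 1 e'; rewrite mulr1 mulr0 add0r; apply; ring.
  by rewrite mxE normrM; case: (i == 0); case: (j == 0); rewrite mulr_ile1.
have := line_proj_dist _ _ _ _ i j e e'; rewrite !spec_mxEproj.
set P := line_proj p q i j in P1 *; set Q := line_proj x y i j.
set I := (1%:M : 'M[R]_2) i j in I1 * => PQ.
have -> : P * a + (I - P) * b - (Q * l + (I - Q) * m) =
  I * (b - m) + P * (a - l) - P * (b - m) + (l - m) * (P - Q) by ring.
have K0 : 0 <= K by exact: le_trans bK.
have M1 c d : `|c| <= 1 -> `|d| <= K -> `|c * d| <= K.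
  by move=> c1 dK; rewrite normrM -[K]mul1r ler_pM.
apply: le_trans (ler_normD _ _) _; apply: lerD; last first.
  by rewrite normrM ger0_norm //; apply: le_trans yE; rewrite ler_wpM2l.
apply: le_trans (ler_normB _ _) _; have := ler_normD (I * (b - m)) (P * (a - l)).
have := M1 _ _ I1 bK; have := M1 _ _ P1 aK; have := M1 _ _ P1 bK; lra.
Qed.

Section Family.
Variables (n : nat) (l m x y : 'I_n -> R) (k : 'I_n) (lam2 : R).
Hypothesis xy1 : forall i, x i ^+ 2 + y i ^+ 2 = 1.
Hypothesis ml : forall i, m i <= l i.
Hypothesis l_max : forall i, l i <= l k.
Hypothesis mk_le : m k <= lam2.
Hypothesis l_le : forall i, i != k -> l i <= lam2.

Let F t i : 'M[R]_2 := spec_mx (expR (t * l i)) (expR (t * m i)) (x i) (y i).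

Lemma expR_mu_le t i : 0 < t -> expR (t * m i) <= expR (t * l i).
Proof. by move=> t0; rewrite ler_expR ler_pM2l. Qed.

Lemma quad_F_ge0 t i p q : 0 <= quad (F t i) p q.
Proof.
by rewrite quad_spec_mx // addr_ge0 // mulr_ge0 ?sqr_ge0 ?expR_ge0.
Qed.

(** Coercivity of the quadratic form at scale [expR (t * lam2)] is assumed here, as it is the one
    estimate that rests on genericity. The bound is explicit and vanishes as [t] grows. *)
Lemma log_sum_exp_dist C t i j : 0 < t -> 1 <= C -> n%:R <= C -> lam2 <= l k ->
  (forall p q, p ^+ 2 + q ^+ 2 = 1 ->
     C^-1 * expR (t * lam2) <= \sum_(i < n) quad (F t i) p q) ->
  `|(t^-1 *: mlog (\sum_(i < n) mexp (t *: spec_mx (l i) (m i) (x i) (y i)))) i j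
    - spec_mx (l k) lam2 (x k) (y k) i j|
  <= 3 * (ln C / t) + Num.sqrt (C * (l k - lam2) / t).
Proof.
move=> t0 C1 nC lam2k coer; have C0 : 0 < C by exact: lt_le_trans C1.
under eq_bigr do rewrite scale_spec_mx mexp_spec_mx //.
rewrite -/(F t); set S := \sum_(i < n) _.
have symS : sym_mx S.
  rewrite /sym_mx /S raddf_sum; apply: eq_bigr => h _; exact: spec_mx_sym.
have [a [b [p [q [pq1 ba ES]]]]] := sym_mx_spec _ symS.
have qS r s : quad S r s = \sum_(i < n) quad (F t i) r s by exact: quad_sum.
have qS_le M r s : r ^+ 2 + s ^+ 2 = 1 ->
    (forall i, quad (F t i) r s <= expR (t * M)) ->
    quad S r s <= C * expR (t * M).
  move=> rs1 HM; rewrite qS; apply: (le_trans (ler_sum _ (fun i _ => HM i))).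
  by rewrite sumr_const card_ord -mulr_natl ler_wpM2r ?expR_ge0.
have bnd r s : r ^+ 2 + s ^+ 2 = 1 -> b <= quad S r s <= a.
  by move=> rs1; rewrite ES quad_spec_mx_bounds.
have sq1 r s : r ^+ 2 + s ^+ 2 = 1 -> (- s) ^+ 2 + r ^+ 2 = 1 :> R.
  by rewrite sqrrN addrC.
(* [(p, q)] and [(- q, p)] are the eigenvectors of [S], so both eigenvalues are sums of quadratic
   forms of the terms. *)
have qa : quad S p q = a.
  rewrite ES quad_spec_mx // (_ : p * q - q * p = 0); last by ring.
  by rewrite -!expr2 pq1; ring.
have qb : quad S (- q) p = b.
  rewrite ES quad_spec_mx // (_ : p * - q + q * p = 0); last by ring.
  rewrite (_ : p * p - q * - q = p ^+ 2 + q ^+ 2); last by ring.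
  by rewrite pq1; ring.
have a_le : a <= C * expR (t * l k).
  rewrite -qa; apply: qS_le => // h.
  have /andP[_ H] := quad_spec_mx_bounds _ _ _ _ _ _ (xy1 h) pq1 (expR_mu_le _ h t0).
  by apply: le_trans H _; rewrite ler_expR ler_pM2l.
have a_ge : expR (t * l k) <= a.
  have /andP[_] := bnd _ _ (xy1 k); apply: le_trans.
  rewrite qS (bigD1 k) //= -[leLHS]addr0 lerD //; last first.
    by apply: sumr_ge0 => h _; exact: quad_F_ge0.
  rewrite quad_spec_mx // -!expr2 xy1 expr1n mulr1.
  by rewrite (_ : x k * y k - y k * x k = 0) ?expr0n ?mulr0 ?addr0 //; ring.
(* At the minor eigenvector of matrix [k], the term [k] contributes only [expR (t * m k)], and every
   other term at most [expR (t * lam2)]. *)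
have v_le : quad S (- y k) (x k) <= C * expR (t * lam2).
  apply: qS_le => [|h]; first exact: sq1.
  have [->|hk] := eqVneq h k.
    rewrite quad_spec_mx // (_ : x k * - y k + y k * x k = 0); last by ring.
    rewrite (_ : x k * x k - y k * - y k = x k ^+ 2 + y k ^+ 2); last by ring.
    by rewrite xy1 expr0n mulr0 add0r expr1n mulr1 ler_expR ler_pM2l.
  have /andP[_ H] :=
    quad_spec_mx_bounds _ _ _ _ _ _ (xy1 h) (sq1 _ _ (xy1 k)) (expR_mu_le _ h t0).
  by apply: le_trans H _; rewrite ler_expR ler_pM2l // l_le.
have b_le : b <= C * expR (t * lam2).
  by apply: le_trans v_le; have /andP[] := bnd _ _ (sq1 _ _ (xy1 k)).
have b_ge : C^-1 * expR (t * lam2) <= b by rewrite -qb qS coer // sq1.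
have b0 : 0 < b by apply: lt_le_trans b_ge; rewrite mulr_gt0 ?invr_gt0 ?expR_gt0.
rewrite ES mlog_spec_mx // scale_spec_mx; apply: spec_mx_dist => //.
- apply: log_ratio_bounds => //; rewrite a_le andbT; apply: le_trans a_ge.
  by rewrite ler_piMl ?expR_ge0 // invf_le1.
- by apply: log_ratio_bounds => //; rewrite b_ge b_le.
- by rewrite subr_ge0.
set d := l k - lam2; set Y := x k * q - y k * p.
have d0 : 0 <= d by rewrite subr_ge0.
(* [a Y^2 <= C e^(t lam2)] and [a >= e^(t l_k)] give [Y^2 <= C e^(- t d)];
   then [d e^(- t d) <= 1 / t] uniformly in [d >= 0]. *)
have aY : expR (t * l k) * Y ^+ 2 <= C * expR (t * lam2).
  apply: le_trans v_le; rewrite ES quad_spec_mx //.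
  rewrite (_ : p * - y k + q * x k = Y); last by rewrite /Y; ring.
  rewrite -[leLHS]addr0 lerD //; first by rewrite ler_wpM2r ?sqr_ge0.
  by rewrite mulr_ge0 ?sqr_ge0 // ltW.
have tdY : t * d * Y ^+ 2 <= C.
  have : expR (t * d) * Y ^+ 2 <= C.
    rewrite /d mulrBr expRB mulrAC ler_pdivrMr ?expR_gt0 //.
  apply: le_trans; rewrite ler_wpM2r ?sqr_ge0 //.
  by apply: le_trans (expR_ge1Dx _); rewrite lerDr.
(* The square root arises from bounding [(d * Y) ^+ 2 * t], which is [t * d * Y ^+ 2] times [d], by
   [C * d]. *)
rewrite -[leLHS]ger0_norm ?mulr_ge0 // normrM normr_id -normrM -sqrtr_sqr.
rewrite ler_wsqrtr // ler_pdivlMr // exprMn.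
rewrite (_ : d ^+ 2 * Y ^+ 2 * t = t * d * Y ^+ 2 * d); last by ring.
by rewrite ler_wpM2r.
Qed.

(** If [lam2] is [m k], term [k] alone suffices. Otherwise terms [k] and [h] both have major
    eigenvalue at least [lam2], and a unit vector cannot be nearly orthogonal to two non-aligned
    directions. *)
Lemma quad_sum_coercive :
  lam2 = m k \/ (exists2 h, h != k & lam2 = l h /\ x k * y h - y k * x h != 0) ->
  exists C, [/\ 1 <= C, n%:R <= C & forall t p q, 0 < t -> p ^+ 2 + q ^+ 2 = 1 ->
     C^-1 * expR (t * lam2) <= \sum_(i < n) quad (F t i) p q].
Proof.
have n1 : 1 <= n%:R :> R by rewrite ler1n; exact: leq_ltn_trans (ltn_ord k).
move=> [->|[h hk [e2 c0]]].
  exists n%:R; split=> // t p q t0 pq1; rewrite (bigD1 k) //= -[leLHS]addr0 lerD //.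
    have /andP[H _] := quad_spec_mx_bounds _ _ _ _ _ _ (xy1 k) pq1 (expR_mu_le _ k t0).
    apply: le_trans H; rewrite ler_piMl ?expR_ge0 // invf_le1 //.
    exact: lt_le_trans n1.
  by apply: sumr_ge0 => h _; exact: quad_F_ge0.
set c := x k * y h - y k * x h in c0.
have c2 : 0 < c ^+ 2 by rewrite exprn_even_gt0.
have i2 : 0 < 2 / c ^+ 2 by rewrite divr_gt0.
(* [2 / c ^+ 2] comes from the bound [u ^+ 2 + w ^+ 2 >= c ^+ 2 / 2] below; adding [n%:R] makes [C]
   dominate [n] and 1. *)
exists (n%:R + 2 / c ^+ 2); split; [lra|lra|] => t p q t0 pq1.
rewrite (bigD1 k) //= (bigD1 h) //= addrA -[leLHS]addr0 lerD //; last first.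
  by apply: sumr_ge0 => g _; exact: quad_F_ge0.
rewrite !quad_spec_mx //.
set u := x k * p + y k * q; set w := x h * p + y h * q.
have Ek : expR (t * lam2) <= expR (t * l k) by rewrite e2 ler_expR ler_pM2l.
(* [c p = u y_h - w y_k] and [c q = w x_k - u x_h]. *)
have cuw : c ^+ 2 <= 2 * (u ^+ 2 + w ^+ 2).
  have -> : c ^+ 2 = (u * y h - w * y k) ^+ 2 + (w * x k - u * x h) ^+ 2.
    transitivity (c ^+ 2 * (p ^+ 2 + q ^+ 2)); first by rewrite pq1 mulr1.
    by rewrite /c /u /w; ring.
  have -> : (u * y h - w * y k) ^+ 2 + (w * x k - u * x h) ^+ 2 =
    u ^+ 2 * (x h ^+ 2 + y h ^+ 2) + w ^+ 2 * (x k ^+ 2 + y k ^+ 2)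
    - 2 * u * w * (x h * x k + y h * y k) by ring.
  have -> : 2 * (u ^+ 2 + w ^+ 2) = u ^+ 2 * (x h ^+ 2 + y h ^+ 2) +
    w ^+ 2 * (x k ^+ 2 + y k ^+ 2) + (u ^+ 2 + w ^+ 2) by rewrite !xy1; ring.
  rewrite lerD2l; have := norm_dot_le1 _ _ _ _ (xy1 h) (xy1 k).
  rewrite ler_norml => /andP[]; set D := _ + _.
  rewrite -subr_ge0 => D1; rewrite -subr_ge0 => D2.
  (* Half the sum of [(u + w)^2 (1 + D)] and [(u - w)^2 (1 - D)] is [u^2 + w^2 + 2 u w D]. *)
  have := mulr_ge0 (sqr_ge0 (u + w)) D1; have := mulr_ge0 (sqr_ge0 (u - w)) D2.
  lra.
have Cinv : (n%:R + 2 / c ^+ 2)^-1 <= c ^+ 2 / 2.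
  rewrite -[leRHS]invrK lef_pV2 ?posrE ?invr_gt0 ?divr_gt0 //; last by lra.
  by rewrite invf_div; lra.
have E0 : 0 <= expR (t * lam2) by exact: expR_ge0.
apply: (@le_trans _ _ (expR (t * lam2) * (u ^+ 2 + w ^+ 2))).
  by rewrite mulrC ler_wpM2l //; apply: le_trans Cinv _; lra.
rewrite mulrDr; apply: lerD; rewrite -[leLHS]addr0; apply: lerD.
- by rewrite ler_wpM2r ?sqr_ge0.
- by rewrite mulr_ge0 ?sqr_ge0 ?expR_ge0.
- by rewrite e2.
- by rewrite mulr_ge0 ?sqr_ge0 ?expR_ge0.
Qed.

End Family.
End LogSumExp.

(** * Generic bases, the limit, and planar perturbations *)

Section Generic.
Local Open Scope classical_set_scope.
Context {R : realType}.
Implicit Types (A B X : 'M[R]_2) (a b l m x y p q s : R).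

Lemma cvg_mx2 (T : Type) (F : set_system T) (FF : Filter F) (G : T -> 'M[R]_2) A :
  (forall i j, (fun t : T => G t i j) @ F --> A i j) -> G @ F --> A.
Proof.
move=> GA; rewrite (matrix_sum_delta A).
rewrite (_ : G = fun t => \sum_i \sum_j G t i j *: delta_mx i j); last first.
  by apply/funext => t; exact: matrix_sum_delta.
rewrite !sum_ord2; under eq_fun do rewrite !sum_ord2.
by do 2! apply: cvgD; apply: cvgZr_tmp; exact: GA.
Qed.

Lemma cvg_spec_mx (T : Type) (F : set_system T) (FF : Filter F) l m (x y : T -> R) p q :
  x @ F --> p -> y @ F --> q ->
  (fun t => spec_mx l m (x t) (y t)) @ F --> spec_mx l m p q.
Proof.
move=> xp yq; apply: cvg_mx2 => i j; rewrite spec_mxEproj.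
under eq_fun do rewrite spec_mxEproj.
have pr : (fun t => line_proj (x t) (y t) i j) @ F --> line_proj p q i j.
  rewrite mxE; under eq_fun do rewrite mxE.
  by apply: cvgM; [case: (i == 0)|case: (j == 0)].
apply: cvgD; first by apply: cvgM => //; exact: cvg_cst.
by apply: cvgM; [apply: cvgB => //|]; exact: cvg_cst.
Qed.

Lemma unit_cross0 x y p q : x ^+ 2 + y ^+ 2 = 1 -> p ^+ 2 + q ^+ 2 = 1 ->
  x * q - y * p = 0 -> (x = p /\ y = q) \/ (x = - p /\ y = - q).
Proof.
move=> e e' c0; have := Lagrange2 _ _ _ _ e e'; rewrite c0 expr0n addr0.
set d := x * p + y * q => /eqP; rewrite sqrf_eq1 => d1.
have ex : x = d * p.
  transitivity (d * p + (x * q - y * p) * q); last by rewrite c0 mul0r addr0.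
  by rewrite -[LHS]mulr1 -e' /d; ring.
have ey : y = d * q.
  transitivity (d * q - (x * q - y * p) * p); last by rewrite c0 mul0r subr0.
  by rewrite -[LHS]mulr1 -e' /d; ring.
case/orP: d1 => /eqP d1; move: ex ey; rewrite d1 ?mul1r ?mulN1r => -> ->.
  by left.
by right.
Qed.

(** Unit vectors are aligned exactly when their cross product vanishes, which makes genericity a
    nonvanishing condition on coordinates. *)
Lemma generic_basesP (n : nat) (Xs : 'I_n -> 'M[R]_2) : generic_bases Xs <->
  exists l m x y : 'I_n -> R,
    [/\ forall i, x i ^+ 2 + y i ^+ 2 = 1, forall i, m i <= l i,
        forall i, Xs i = spec_mx (l i) (m i) (x i) (y i) &
        forall i j, i != j -> x i * y j - y i * x j != 0].
Proof.
split=> [[l [m [u [v [sf gen]]]]]|[l [m [x [y [e ml EX gen]]]]]].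
  have sp i := spectral_form_spec_mx _ _ _ _ _ (sf i).
  exists l, m, (fun i => u i 0 0), (fun i => u i 1 0).
  split=> [i|i|i|i j ij]; try by case: (sp i).
  have [ei _ _ _] := sp i; have [ej _ _ _] := sp j; have [ne nN] := gen i j ij.
  apply/eqP => /(unit_cross0 _ _ _ _ ei ej)[[e0 e1]|[e0 e1]].
    by apply: ne; exact: cV2P.
  by apply: nN; apply: cV2P; rewrite !mxE.
exists l, m, (fun i => \col_h (if h == 0 then x i else y i)),
  (fun i => \col_h (if h == 0 then - y i else x i)); split=> [i|i j ij].
  by rewrite EX; exact: spec_mx_spectral_form.
have := gen i j ij => /eqP c0.
split=> /colP E; apply: c0; have := E 0; have := E 1; rewrite !mxE /= => -> ->.
  by ring.
by ring.
Qed.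

(** For [l != m], the affine map of [X] that keeps the eigenvalue [l] and moves [m] to [lam2], with
    no reference to eigenvectors. For [l = m] the quotient is 0 and the value [lam2%:M] is still
    right, as [lam2] lies between [m] and [l]. *)
Definition spectral_stretch (l m lam2 : R) X : 'M[R]_2 :=
  lam2%:M + ((l - lam2) / (l - m)) *: (X - m%:M).

Lemma spectral_stretch_spec_mx l m lam2 x y : m <= lam2 <= l ->
  spectral_stretch l m lam2 (spec_mx l m x y) = spec_mx l lam2 x y.
Proof.
move=> /andP[m2 l2]; rewrite /spectral_stretch /spec_mx.
rewrite [m%:M + _]addrC addrK scalerA; congr (_ + _ *: _).
have [lm|lm] := eqVneq l m; last by rewrite divfK // subr_eq0.
have -> : l = lam2 by lra.
by rewrite subrr !mul0r.
Qed.

Lemma cvg_spectral_stretch (T : Type) (F : set_system T) (FF : Filter F)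
    l m lam2 (X : T -> 'M[R]_2) A :
  X @ F --> A -> (fun t => spectral_stretch l m lam2 (X t)) @ F -->
                 spectral_stretch l m lam2 A.
Proof.
move=> XA; apply: cvgD; first exact: cvg_cst.
by apply: cvgZl_tmp; apply: cvgB => //; exact: cvg_cst.
Qed.

(** Eigenvalues are prescribed through trace and determinant, which planar families preserve;
    [sum_prod_inj] identifies them with those supplied by the generic bases. *)
Lemma SupLE_generic (n : nat) (Xs : 'I_n -> 'M[R]_2) (lam mu : 'I_n -> R) k lam2 :
  generic_bases Xs -> (forall i, \tr (Xs i) = lam i + mu i) ->
  (forall i, \det (Xs i) = lam i * mu i) -> (forall i, mu i <= lam i) ->
  (forall i, lam i <= lam k) -> mu k <= lam2 <= lam k ->
  (forall i, i != k -> lam i <= lam2) ->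
  lam2 = mu k \/ (exists2 h, h != k & lam2 = lam h) ->
  SupLE_is Xs (spectral_stretch (lam k) (mu k) lam2 (Xs k)).
Proof.
move=> /generic_basesP[l [m [x [y [e ml EX gen]]]]] trX detX le max lam2k oth att.
have lm i : l i = lam i /\ m i = mu i.
  have [tr dt] := spec_mx_tr_det (l i) (m i) _ _ (e i).
  by apply: sum_prod_inj => //; rewrite -?tr -?dt -EX ?trX ?detX.
have El : l = lam by apply/funext => i; case: (lm i).
have Em : m = mu by apply/funext => i; case: (lm i).
rewrite {}El {}Em {lm} in ml EX.
have att' : lam2 = mu k \/
    exists2 h, h != k & lam2 = lam h /\ x k * y h - y k * x h != 0.
  case: att => [->|[h hk ->]]; first by left.
  by right; exists h => //; split=> //; apply: gen; rewrite eq_sym.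
have [C [C1 nC coer]] := quad_sum_coercive _ _ _ _ _ _ lam2 e le max att'.
rewrite EX spectral_stretch_spec_mx //; move: lam2k => /andP[mu2 l2].
apply: cvg_mx2 => i j; apply/subr_cvg0/norm_cvg0P.
pose E t := 3 * (ln C / t) + Num.sqrt (C * (lam k - lam2) / t).
have tV : (fun t : R => t^-1) @ +oo --> (0 : R).
  by apply/gtr0_cvgV0; [exact: nbhs_pinfty_gt|exact: cvg_id].
have E0 : E @ +oo --> (0 : R).
  rewrite (_ : 0 = 3 * (ln C * 0) + Num.sqrt (C * (lam k - lam2) * 0)); last first.
    by rewrite !mulr0 sqrtr0 addr0.
  apply: cvgD; first by do 2! apply: cvgMr.
  by apply: continuous_cvg; [exact: sqrt_continuous|exact: cvgMr].
apply: (squeeze_cvgr _ (cvg_cst 0) E0); near=> t.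
have t0 : 0 < t by near: t; exact: nbhs_pinfty_gt.
rewrite normr_ge0 /=; under eq_bigr do rewrite EX.
by apply: log_sum_exp_dist => // p q pq1; exact: coer.
Unshelve. all: by end_near. Qed.

(** The length of [(x, y) + z (- y, x)] for a unit vector [(x, y)]. *)
Definition tilt_norm (z : R) := Num.sqrt (1 + z ^+ 2).

Lemma tilt_norm_sqr z : tilt_norm z ^+ 2 = 1 + z ^+ 2.
Proof. by rewrite sqr_sqrtr // addr_ge0 // sqr_ge0. Qed.

Lemma tilt_norm_neq0 z : tilt_norm z != 0.
Proof.
by rewrite -sqrf_eq0 tilt_norm_sqr gt_eqF // ltr_pwDl // sqr_ge0.
Qed.

(* The i-th frame is tilted by slope [i s]: aligned frames separate because the
   slopes differ, and frames that were not aligned stay so for small [s]. *)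
Lemma planar_family_exists (n : nat) (lam mu x y : 'I_n -> R) :
  (forall i, x i ^+ 2 + y i ^+ 2 = 1) -> (forall i, mu i <= lam i) ->
  exists Xd : R -> 'I_n -> 'M[R]_2,
    converges_planar Xd (fun i => spec_mx (lam i) (mu i) (x i) (y i)) /\
    forall d, 0 < d -> generic_bases (Xd d).
Proof.
move=> e ml.
pose c (i j : 'I_n) := x i * y j - y i * x j.
pose p (i j : 'I_n) := x i * x j + y i * y j.
(* [w i j s] is the cross product of the major vectors [i] and [j] after tilting, before
   normalisation. *)
pose w (i j : 'I_n) s := c i j * (1 + i%:R * j%:R * s ^+ 2) + s * ((j%:R - i%:R) * p i j).
have [s0 s00 ws0] : exists2 s0, 0 < s0 &
    forall s, 0 < s -> s < s0 -> forall i j : 'I_n, i != j -> w i j s != 0.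
  have : \forall s \near (0 : R)^'+, forall i j : 'I_n, i != j -> w i j s != 0.
    apply: filter_forall => i; apply: filter_forall => j.
    have [c0|c0] := eqVneq (c i j) 0.
      near=> s => ij; rewrite /w c0 mul0r add0r; apply: mulf_neq0.
        by apply: lt0r_neq0; near: s; exact: nbhs_right_gt.
      apply: mulf_neq0; first by rewrite subr_eq0 eqr_nat eq_sym.
      have := Lagrange2 _ _ _ _ (e i) (e j); rewrite -/(c i j) -/(p i j) c0.
      rewrite expr0n addr0 => p1.
      by rewrite -sqrf_eq0 p1 oner_neq0.
    have : w i j s @[s --> 0^'+] --> c i j.
      apply: cvg_at_right_filter.
      rewrite -[X in _ --> X](_ : w i j 0 = _); last by rewrite /w; ring.
      apply: cvgD; last by apply: cvgMl; exact: cvg_id.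
      apply: cvgMr; apply: cvgD; first exact: cvg_cst.
      by apply: cvgMr; exact: exprn_continuous.
    by move=> /cvgr_neq0/(_ c0); apply: filterS.
  move=> [s0 /= s00 H]; exists s0 => // s sp ss0; apply: H => //=.
  by rewrite sub0r normrN gtr0_norm.
(* Genericity is required for every [d > 0], not only for small [d], so the slope is capped below
   [s0]. *)
pose sd (d : R) := Num.min d (s0 / 2).
have sd0 d : 0 < d -> 0 < sd d by move=> d0; rewrite lt_min d0 divr_gt0.
have sds0 d : sd d < s0 by rewrite gt_min [X in _ || X](_ : _ = true) ?orbT //; lra.
have sd_cvg : sd d @[d --> 0^'+] --> 0.
  apply: (@squeeze_cvgr _ _ _ _ (cst 0) id).
  - near=> d; rewrite ge_min lexx ltW //=; exact: sd0.
  - exact: cvg_cst.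
  - exact/cvg_at_right_filter/cvg_id.
pose N i d := tilt_norm (i%:R * sd d).
pose xd (i : 'I_n) d := (x i - i%:R * sd d * y i) / N i d.
pose yd (i : 'I_n) d := (y i + i%:R * sd d * x i) / N i d.
have ed i d : xd i d ^+ 2 + yd i d ^+ 2 = 1.
  rewrite !expr_div_n -mulrDl tilt_norm_sqr.
  rewrite [X in X / _](_ : _ = (x i ^+ 2 + y i ^+ 2) * (1 + (i%:R * sd d) ^+ 2)); last by ring.
  by rewrite e mul1r -tilt_norm_sqr divff // expf_neq0 // tilt_norm_neq0.
exists (fun d i => spec_mx (lam i) (mu i) (xd i d) (yd i d)); split; [split|].
- move=> i.
  have z0 : i%:R * sd d @[d --> 0^'+] --> (0 : R).
    by rewrite -[X in _ --> X](mulr0 i%:R); exact: cvgMr.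
  have N1 : (N i d)^-1 @[d --> 0^'+] --> (1 : R).
    rewrite -[X in _ --> X]invr1; apply: cvgV; first exact: oner_neq0.
    rewrite -[X in _ --> X]sqrtr1; apply: continuous_cvg.
      exact: sqrt_continuous.
    rewrite -[X in _ --> X](_ : 1 + 0 ^+ 2 = _); last by ring.
    apply: cvgD; first exact: cvg_cst.
    by under eq_fun do rewrite expr2; rewrite expr2; exact: cvgM.
  apply: cvg_spec_mx.
  + rewrite -[X in _ --> X](_ : (x i - 0 * y i) * 1 = _); last by ring.
    by apply: cvgM => //; apply: cvgB; [exact: cvg_cst|exact: cvgMl].
  + rewrite -[X in _ --> X](_ : (y i + 0 * x i) * 1 = _); last by ring.
    by apply: cvgM => //; apply: cvgD; [exact: cvg_cst|exact: cvgMl].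
- move=> d d0 i; split; first exact: spec_mx_sym.
  apply/char_poly2_eq; have [-> ->] := spec_mx_tr_det (lam i) (mu i) _ _ (ed i d).
  by have [-> ->] := spec_mx_tr_det (lam i) (mu i) _ _ (e i).
move=> d d0; apply/generic_basesP; exists lam, mu, (xd^~ d), (yd^~ d).
split=> // i j ij.
rewrite (_ : _ - _ = w i j (sd d) / (N i d * N j d)).
  by rewrite mulf_neq0 ?ws0 ?sd0 ?invr_eq0 ?mulf_neq0 ?tilt_norm_neq0.
rewrite /xd /yd /w /c /p; field.
by rewrite !tilt_norm_neq0.
Unshelve. all: by end_near. Qed.

End Generic.

(** * Eigenvalue multi-sets and the formula *)

Theorem theorem5 (R : realType) (n : nat) (Xs : 'I_n -> 'M[R]_2)
    (lam mu : 'I_n -> R) (k : 'I_n) (u1 v1 : 'cV[R]_2) (lam2 : R) :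
  (forall i, sym_mx (Xs i)) ->
  (forall i, exists u v : 'cV[R]_2, spectral_form (Xs i) (lam i) (mu i) u v) ->
  spectral_form (Xs k) (lam k) (mu k) u1 v1 ->
  let eigs := [seq lam i | i <- enum 'I_n] ++ [seq mu i | i <- enum 'I_n] in
  (forall x, x \in eigs -> x <= lam k) ->
  lam2 \in rem (lam k) eigs ->
  (forall x, x \in rem (lam k) eigs -> x <= lam2) ->
  SupRLE_is Xs
    (if count_mem (lam k) eigs == 1%N
     then lam k *: (u1 *m u1^T) + lam2 *: (v1 *m v1^T)
     else lam k *: 1%:M).
Proof.
move=> _ sf sfk eigs max lam2_in lam2_max.
have lamkE : lam k \in eigs.
  by rewrite mem_cat map_f // mem_enum.
(* [rem] may delete an occurrence of the value [lam k] at another index; up to permutation this is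
   the same as deleting the index [k]. *)
have permE : perm_eq (rem (lam k) eigs)
    ([seq lam i | i <- rem k (enum 'I_n)] ++ [seq mu i | i <- enum 'I_n]).
  rewrite -(perm_cons (lam k)) -cat_cons -map_cons.
  rewrite perm_sym (perm_trans _ (perm_to_rem lamkE)) // perm_cat2r perm_map //.
  by rewrite perm_sym perm_to_rem // mem_enum.
have memE z : (z \in rem (lam k) eigs) =
    (z \in [seq lam i | i <- rem k (enum 'I_n)]) || (z \in [seq mu i | i <- enum 'I_n]).
  by rewrite (perm_mem permE) mem_cat.
have lam_max i : lam i <= lam k.
  by apply: max; rewrite mem_cat map_f // mem_enum.
have mu2 i : mu i <= lam2.
  by apply: lam2_max; rewrite memE orbC map_f // mem_enum.
have oth i : i != k -> lam i <= lam2.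
  move=> ik; apply: lam2_max; rewrite memE map_f // mem_rem_uniq ?enum_uniq //.
  by rewrite !inE ik mem_enum.
have ml i : mu i <= lam i by have [u [v []]] := sf i.
have l2 : lam2 <= lam k by apply: max; exact: mem_rem lam2_in.
have att : lam2 = mu k \/ (exists2 h, h != k & lam2 = lam h).
  move: lam2_in; rewrite memE => /orP[|] /mapP[h].
    by rewrite mem_rem_uniq ?enum_uniq // !inE => /andP[hk _] ->; right; exists h.
  (* If [lam2] is [mu h] with [h != k], then [mu h <= lam h <= lam2] forces [lam h = lam2]. *)
  have [->|hk] := eqVneq h k; first by left.
  move=> _ e2; right; exists h => //; apply/eqP; rewrite eq_le oth // andbT.
  by rewrite e2 ml.
have [_ _ EXk Ek] := spectral_form_spec_mx _ _ _ _ _ sfk.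
have mk2 : mu k <= lam2 <= lam k by rewrite mu2.
have -> : (if count_mem (lam k) eigs == 1%N
     then lam k *: (u1 *m u1^T) + lam2 *: (v1 *m v1^T)
     else lam k *: 1%:M) = spectral_stretch (lam k) (mu k) lam2 (Xs k).
  rewrite [in RHS]EXk spectral_stretch_spec_mx // -Ek.
  have [//|cnt] := eqVneq.
  (* A repeated [lam k] survives the removal, so [lam2 = lam k] and the stretched matrix is
     scalar. *)
  have lamk_rem : lam k \in rem (lam k) eigs.
    move: cnt; rewrite (permP (perm_to_rem lamkE)) /= eqxx -has_pred1 has_count.
    by case: count.
  have -> : lam2 = lam k by apply/eqP; rewrite eq_le l2 lam2_max.
  by rewrite Ek /spec_mx subrr scale0r addr0 scalemx1.
have td i : \tr (Xs i) = lam i + mu i /\ \det (Xs i) = lam i * mu i.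
  have [u [v /spectral_form_spec_mx[e _ -> _]]] := sf i.
  exact: spec_mx_tr_det.
rewrite /SupRLE_is; case: asboolP => gen.
  apply: SupLE_generic => // i; by case: (td i).
split.
  have /fin_all_exists[u Hu] : forall i, exists u : 'cV[R]_2,
      u 0 0 ^+ 2 + u 1 0 ^+ 2 = 1 /\ Xs i = spec_mx (lam i) (mu i) (u 0 0) (u 1 0).
    move=> i; have [u [v /spectral_form_spec_mx[e _ EX _]]] := sf i.
    by exists u.
  rewrite (_ : Xs = fun i => spec_mx (lam i) (mu i) (u i 0 0) (u i 1 0)).
    by apply: planar_family_exists => // i; case: (Hu i).
  by apply/funext => i; case: (Hu i).
move=> Xd [Xd_cvg Xd_eig] gend.
(* The eigenvalues of the family are constant in [d], so one affine map gives the supremum for each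
   [d], and its continuity gives the limit. *)
exists (fun d => spectral_stretch (lam k) (mu k) lam2 (Xd d k)); split=> [d d0|].
  have tdd i : \tr (Xd d i) = lam i + mu i /\ \det (Xd d i) = lam i * mu i.
    by have [_ /char_poly2_eq[-> ->]] := Xd_eig d d0 i.
  by apply: SupLE_generic => //; [exact: gend|move=> i; case: (tdd i)..].
exact: cvg_spectral_stretch.
Qed.
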